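(* Let $p$ be a prime number and $s \in \mathbb{N}$. Let $D_{p^s} = \langle a, b \mid a^{p^s} = b^2 = 1,\ bab = a^{-1}\rangle$ be the dihedral group of order $2p^s$, and let $C_{p^s} = \langle a \rangle$ be its cyclic subgroup of order $p^s$. Let $H$ be a connecting set for the Cayley graph $\mathrm{Cay}(D_{p^s}, H)$. Then $\mathrm{Cay}(D_{p^s}, H)$ is non-singular if the following two conditions hold: (1) $|H \cap C_{p^s}| \neq |H \cap C_{p^s} b|$; (2) $|H| < p$.
   Context: For a finite group $G$, a subset $H \subseteq G$ is called a connecting set if (i) $H^{-1} = \{h^{-1} : h \in H\} = H$, (ii) $1_G \notin H$, and (iii) $H$ generates $G$. The Cayley graph $\mathrm{Cay}(G,H)$ is the graph with vertex set $G$ in which $u, v \in G$ are adjacent if and only if $vu^{-1} \in H$. A finite simple graph is singular if its adjacency matrix $A$ is singular, i.e. if $0$ is an eigenvalue of $A$; otherwise it is non-singular. *)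

(* Defs.v *)
From HB Require Import structures.
From mathcomp Require Import all_boot all_order all_algebra all_fingroup.
From mathcomp Require Import all_solvable.

Set Implicit Arguments.
Unset Strict Implicit.
Unset Printing Implicit Defensive.

Local Open Scope group_scope.

(* gT is the group < a, b | a ^ n = b ^ 2 = 1, b a b = a ^ -1 >, with a and b
   the generators of the presentation.  The [\isog Grp] clause only names the
   isomorphism type of gT; as gT is finite, a generating pair satisfying the
   relations differs from the canonical one by an automorphism, so the first
   four clauses identify a and b. *)
Definition dihedral_presentation (gT : finGroupType) (n : nat) (a b : gT) :
    Prop :=
  [/\ <[a]> <*> <[b]> = [set: gT],
      a ^+ n = 1, b ^+ 2 = 1, b * a * b = a^-1
    & [set: gT] \isog Grp (x : y : x ^+ n, y ^+ 2, y * x * y = x^-1)].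

Definition connecting_set (gT : finGroupType) (H : {set gT}) : Prop :=
  [/\ [set h^-1 | h in H] = H, 1 \notin H & <<H>> = [set: gT]].

Definition cayley_graph (gT : finGroupType) (H : {set gT}) : rel gT :=
  fun u v => v * u^-1 \in H.

(* Rows and columns follow the enumeration of T.  The entries are 0 or 1, so
   invertibility over rat is the same as over any field of characteristic 0. *)
Definition adjacency_mx (T : finType) (e : rel T) : 'M[rat]_#|T| :=
  \matrix_(i < #|T|, j < #|T|) (e (enum_val i) (enum_val j))%:R%R.

Definition singular_graph (T : finType) (e : rel T) : bool :=
  adjacency_mx e \notin unitmx.

(* Main.v *)
(** Reducing the adjacency operator modulo [p] keeps it invertible. Right
    translation by [a] commutes with it and is unipotent in characteristic [p],
    because [a] has [p]-power order; so a nonzero kernel over ['F_p] would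
    contain a nonzero function fixed by that translation, i.e. one taking a
    single value [x] on [<[a]>] and a single value [y] on [<[a]> :* b]. With
    [m] and [k] the numbers of elements of [H] in the two cosets, the kernel
    equations become [m x + k y = 0 = k x + m y], whose determinant
    [(m - k) (m + k)] is prime to [p], as [m <> k] and [m + k < p]. *)
Require Import Defs.
From HB Require Import structures.
From mathcomp Require Import all_boot all_order all_algebra all_fingroup.
From mathcomp Require Import all_solvable.
From mathcomp Require Import ring.

Import GRing.Theory Num.Theory.

Local Open Scope ring_scope.

(** [P - 1] is nilpotent, so a kernel vector [u] has a last nonzero iterate under it. That iterate
    is fixed by [P], and it stays in the kernel because [P] commutes with [M]. *)
Lemma unipotent_fixed_kernel {F : fieldType} {p s n : nat} {M P : 'M[F]_n} :
    p \in [pchar F] -> P ^+ (p ^ s) = 1 -> P *m M = M *m P ->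
    M \notin unitmx ->
  exists v : 'rV_n, [/\ v != 0, v *m M = 0 & v *m P = v].
Proof.
case: n M P => [|n] M P charFp P1 PM; first by rewrite unitmxE det_mx00 unitr1.
rewrite -row_free_unit -kermx_eq0 => /rowV0Pn[u /sub_kermxP uM nz_u].
have nilU : (P - 1) ^+ (p ^ s) = 0.
  (* Frobenius is additive in the commutative ring [{poly F}]; evaluating at [P] carries the
     identity over to matrices. *)
  have charXp : p \in [pchar {poly F}] by rewrite pchar_poly.
  have /(congr1 (horner_mx P)) :
      ('X - 1) ^+ (p ^ s) = 'X^(p ^ s) - 1 :> {poly F}.
    elim: s {P1} => [|k IHk]; first by rewrite !expr1.
    by rewrite expnSr !exprM IHk -!(pFrobenius_autE charXp) pFrobenius_autB_comm
               ?pFrobenius_aut1 //; apply: mulrC.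
  by rewrite rmorphXn !rmorphB /= rmorph1 rmorphXn /= horner_mx_X P1 subrr.
have vanish : exists k, u *m (P - 1) ^+ k == 0.
  by exists (p ^ s)%N; rewrite nilU mulmx0.
case: (ex_minnP vanish) => -[|k] uk0 min_k.
  by rewrite expr0 mulmx1 (negPf nz_u) in uk0.
exists (u *m (P - 1) ^+ k); split.
- by apply/negP=> /min_k; rewrite ltnn.
- have cMU : GRing.comm M ((P - 1) ^+ k).
    by apply/commrX/commrB; [exact/esym | exact: commr1].
  by rewrite -mulmxA -[_ *m M]/(_ * M) -cMU mulmxA uM mul0mx.
- apply/eqP; rewrite -subr_eq0 -[X in _ - X]mulmx1 -mulmxBr.
  by rewrite -mulmxA -[_ *m (P - _)]/(_ * (P - 1)) -exprSr.
Qed.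

(** Both matrices are images of one 0/1 integer matrix, so a determinant that vanishes over [rat]
    also vanishes over ['F_p]. *)
Lemma adjacency_det_intr (T : finType) (e : rel T) (R : comNzRingType) :
  exists d : int,
  \det (adjacency_mx e) = d%:~R /\
  \det (\matrix_(i < #|T|, j < #|T|)
          (e (enum_val i) (enum_val j))%:R : 'M[R]_#|T|) = d%:~R.
Proof.
exists (\det (\matrix_(i < #|T|, j < #|T|) (e (enum_val i) (enum_val j))%:R)).
by rewrite -!det_map_mx; split; congr (\det _); apply/matrixP=> i j;
  rewrite !mxE rmorph_nat.
Qed.

Lemma singular_kernel_fun {p s : nat} {gT : finGroupType} {a : gT}
    {H : {set gT}} :
    prime p -> (a ^+ (p ^ s) = 1)%g -> [set h^-1%g | h in H] = H ->
    singular_graph (cayley_graph H) ->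
  exists f : gT -> 'F_p,
  [/\ exists u, f u != 0, forall u, f (u * a)%g = f u
    & forall w, \sum_(h in H) f (h * w)%g = 0].
Proof.
move=> p_pr a1 symH.
have memH h : (h^-1 \in H)%g = (h \in H).
  by rewrite -{1}symH mem_imset //; apply: invg_inj.
have [d [detQ detF]] := adjacency_det_intr gT (cayley_graph H) 'F_p.
rewrite /singular_graph unitmxE detQ unitfE negbK intr_eq0 => /eqP d0.
rewrite d0 mulr0z in detF.
set M := (X in \det X = _) in detF.
(* On row vectors, seen as functions on the group, [rho g] sends [f] to [u |-> f (u * g)]. *)
pose rho g : 'M['F_p]_#|gT| :=
    \matrix_(i, j) (enum_val i == enum_val j * g)%g%:R.
have mul_rho m (A : 'M['F_p]_(m, #|gT|)) g i j :
    (A *m rho g) i j = A i (enum_rank (enum_val j * g)%g).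
  rewrite mxE (bigD1 (enum_rank (enum_val j * g)%g)) //= big1 => [|k ne_k].
    by rewrite mxE enum_rankK eqxx mulr1 addr0.
  by rewrite mxE -(inj_eq enum_rank_inj) enum_valK (negPf ne_k) mulr0.
have rho1 : rho a ^+ (p ^ s) = 1.
  have -> k : rho a ^+ k = rho (a ^+ k)%g.
    elim: k => [|k IHk].
      by apply/matrixP=> i j; rewrite !mxE mulg1 (inj_eq enum_val_inj).
    by apply/matrixP=> i j; rewrite exprSr IHk mul_rho !mxE enum_rankK expgS mulgA.
  by rewrite a1; apply/matrixP=> i j; rewrite !mxE mulg1 (inj_eq enum_val_inj).
(* Adjacency depends only on [v * u^-1], which right translation of both vertices leaves
   unchanged. *)
have comm_rho : rho a *m M = M *m rho a.
  apply/matrixP=> i j; rewrite mul_rho !mxE enum_rankK.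
  rewrite (bigD1 (enum_rank (enum_val i * a^-1)%g)) //= big1 => [|k ne_k].
    rewrite !mxE enum_rankK mulgKV eqxx mul1r addr0 /cayley_graph.
    by rewrite invMg invgK mulgA.
  rewrite mxE eq_sym (canF_eq (mulgK a)).
  by rewrite -(inj_eq enum_rank_inj) enum_valK (negPf ne_k) mul0r.
have singM : M \notin unitmx by rewrite unitmxE detF unitr0.
have [v [nz_v vM va]] :=
  unipotent_fixed_kernel (pchar_Fp p_pr) rho1 comm_rho singM.
exists (fun u => v 0 (enum_rank u)); split.
- by have /rV0Pn[i] := nz_v; exists (enum_val i); rewrite enum_valK.
- by move=> u; rewrite -{2}va mul_rho enum_rankK.
(* Write the summation vertex as [h * w]: it is adjacent to [w] when [h^-1] is in [H], that is, when
   [h] is. *)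
move=> w; have /rowP/(_ (enum_rank w)) := vM; rewrite !mxE => vMw; rewrite -[RHS]vMw.
rewrite (reindex_onto enum_rank enum_val) => [|i _]; last exact: enum_valK.
rewrite [RHS](reindex_inj (mulIg w)) big_mkcond /=.
apply: eq_big => [h|h _]; first by rewrite enum_rankK eqxx.
rewrite mxE !enum_rankK /cayley_graph invMg mulKVg memH.
by case: (h \in H); rewrite ?mulr1 ?mulr0.
Qed.

(** Eliminating [y] leaves [x] times the determinant. The hypotheses are symmetric in [x] and [y],
    so swapping them gives [y = 0] as well. *)
Lemma circulant2_kernel {F : fieldType} {m k x y : F} :
    (m - k) * (m + k) != 0 -> x * m + y * k = 0 -> y * m + x * k = 0 -> x = 0.
Proof.
move=> nz_det eq1 eq2; apply/(mulIf nz_det); rewrite mul0r.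
transitivity ((x * m + y * k) * m - (y * m + x * k) * k); first by ring.
by rewrite eq1 eq2 !mul0r subrr.
Qed.

Theorem theorem3p4 (p s : nat) (p_prime : prime p)
    (gT : finGroupType) (a b : gT)
    (gT_dihedral : dihedral_presentation (p ^ s)%N a b)
    (H : {set gT}) (H_connecting : connecting_set H)
    (H_unbalanced : #|H :&: <[a]>%g| <> #|H :&: (<[a]> :* b)%g|)
    (H_small : (#|H| < p)%N) :
  ~~ singular_graph (cayley_graph H).
Proof.
have [genab a1 b2 bab _] := gT_dihedral.
have [symH _ _] := H_connecting.
apply/negP=> /(singular_kernel_fun p_prime a1 symH)[f [[w nz_fw] fa sumf]].
have b_inv : (b^-1 = b)%g by apply/eqP; rewrite eq_invg_mul -expg2 b2.
have nCb : b \in 'N(<[a]>)%g.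
  by rewrite inE -cycleJ cycle_subG conjgE b_inv mulgA bab groupV cycle_id.
have fC u c : c \in <[a]>%g -> f (u * c)%g = f u.
  case/cycleP=> i ->; elim: i => [|i IHi]; first by rewrite mulg1.
  by rewrite expgSr mulgA fa.
have cos u : u \notin <[a]>%g -> u \in (<[a]> :* b)%g.
  have : u \in (<[a]> <*> <[b]>)%g by rewrite genab inE.
  rewrite norm_joinEr ?cycle_subG // => /mulsgP[c _ Cc /cycleP[i ->] ->].
  rewrite -(expg_mod _ b2) modn2 mem_rcoset; case: (odd i); last first.
    by rewrite mulg1 Cc.
  by rewrite mulgK Cc.
(* Otherwise the two cosets would coincide and the two counts would agree. *)
have notCb : b \notin <[a]>%g.
  by apply/negP=> Cb; apply: H_unbalanced; rewrite rcoset_id.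
(* As [b] normalizes [<[a]>], this right coset is also the left coset of [b], on which right
   invariance makes [f] constant. *)
have fcos u : u \in (<[a]> :* b)%g -> f u = f b.
  by rewrite norm_rlcoset // => /lcosetP[c Cc ->]; apply: fC.
have HD : H :\: <[a]>%g = H :&: (<[a]> :* b)%g.
  apply/setP=> h; rewrite !inE andbC; case: (h \in H) => //=.
  apply/idP/idP=> [/cos // | ]; rewrite mem_rcoset b_inv => Chb.
  by apply: contra notCb => Ch; rewrite -(groupMl _ Ch).
set m := #|_| in H_unbalanced; set k := #|_| in H_unbalanced.
have eq1 : f 1%g *+ m + f b *+ k = 0.
  rewrite -(sumf 1%g) (big_setID <[a]>%g) HD /= -!sumr_const.
  congr (_ + _); apply: eq_bigr => h; rewrite inE mulg1 => /andP[_ Ch].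
    by rewrite -(fC 1%g _ Ch) mul1g.
  by rewrite fcos.
(* Right multiplication by [b] swaps the two cosets, hence the roles of [f 1] and [f b]. *)
have eqb : f b *+ m + f 1%g *+ k = 0.
  rewrite -(sumf b) (big_setID <[a]>%g) HD /= -!sumr_const.
  congr (_ + _); apply: eq_bigr => h; rewrite inE => /andP[_ Ch].
    by rewrite fcos // mem_rcoset mulgK.
  by rewrite -(fC 1%g _ (_ : h * b \in <[a]>)%g) ?mul1g // -{1}b_inv -mem_rcoset.
have mkH : (m + k < p)%N by rewrite /m /k -HD cardsID.
(* Both [m + k] and the distance between [m] and [k] are positive and less than [p]. *)
have nz_det : (m%:R - k%:R) * (m%:R + k%:R) != 0 :> 'F_p.
  have nzF n : (0 < n < p)%N -> n%:R != 0 :> 'F_p.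
    by case/andP=> *; rewrite -(dvdn_pcharf (pchar_Fp p_prime)) gtnNdvd.
  rewrite mulf_neq0 //; last first.
    rewrite -natrD nzF // mkH andbT lt0n addn_eq0.
    by apply: contra_notN H_unbalanced => /andP[/eqP-> /eqP->].
  case: (ltngtP m k) => [lt_mk | lt_km | //].
    rewrite -opprB oppr_eq0 -natrB 1?ltnW // nzF // subn_gt0 lt_mk.
    by rewrite (leq_ltn_trans _ mkH) // (leq_trans (leq_subr _ _)) ?leq_addl.
  rewrite -natrB 1?ltnW // nzF // subn_gt0 lt_km.
  by rewrite (leq_ltn_trans _ mkH) // (leq_trans (leq_subr _ _)) ?leq_addr.
rewrite -(mulr_natr _ m) -(mulr_natr _ k) in eq1.
rewrite -(mulr_natr _ m) -(mulr_natr _ k) in eqb.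
have f1 : f 1%g = 0 := circulant2_kernel nz_det eq1 eqb.
have fb : f b = 0 := circulant2_kernel nz_det eqb eq1.
case/eqP: nz_fw; have [Cw | /cos/fcos-> //] := boolP (w \in <[a]>%g).
by rewrite -[w]mul1g fC.
Qed.
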